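(* Let $E$ be a finite-dimensional real vector space and let $\mathfrak g\subset\mathfrak{gl}(E)$ be a Berger algebra which preserves two supplementary subspaces $V_1$ and $V_2$ (so $E=V_1\oplus V_2$) and a non-degenerate symmetric bilinear form $\langle\cdot,\cdot\rangle$. Let $\theta=\theta_{\mathcal V}$ for $\mathcal V=(E,V_1,V_2,V_1^\perp,V_2^\perp)$. Then $\mathfrak g E\subset\ker\theta_{\mathcal V}$ and $\mathfrak g\,\mathrm{im}\,\theta_{\mathcal V}=\{0\}$.
   Context: A formal curvature tensor on $E$ is an element $R$ of $(E^*\wedge E^* )\otimes E^*\otimes E$, regarded as a map $(x,y)\mapsto R(x,y)\in\mathrm{End}(E)$ that is bilinear and antisymmetric, such that $R(x,y)z+R(y,z)x+R(z,x)y=0$ for all $x,y,z\in E$. A Lie subalgebra $\mathfrak g\subset\mathfrak{gl}(E)$ is a Berger algebra if there is a finite set of formal curvature tensors $\{R_1,\dots,R_m\}$ such that $\mathfrak g$ is the linear Lie algebra generated by the endomorphisms $R_i(x,y)$, $i=1,\dots,m$, $x,y\in E$. The form is preserved by $\mathfrak g$ if $\langle ax,y\rangle+\langle x,ay\rangle=0$ for all $a\in\mathfrak g$, $x,y\in E$. If $E=E_1\oplus E_2$, $p_{E_1}^{E_2}$ denotes the projection onto $E_1$ along $E_2$. For $\mathcal V=(E,V_1,V_2,W_1,W_2)$ with $E=V_1\oplus V_2=W_1\oplus W_2$, $\theta_{\mathcal V}=p_{W_1}^{W_2}\circ p_{V_1}^{V_2}-p_{V_1}^{V_2}\circ p_{W_1}^{W_2}$.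 Here $W_j=V_j^\perp$, and $E=V_1^\perp\oplus V_2^\perp$ by non-degeneracy. $\mathfrak gE$ denotes the span of all $ax$, $a\in\mathfrak g$, $x\in E$. *)

(* Defs.v *)
From HB Require Import structures.
From mathcomp Require Import all_boot all_order all_algebra.
From mathcomp Require Import reals.

Set Implicit Arguments.
Unset Strict Implicit.
Unset Printing Implicit Defensive.

Import GRing.Theory.
Local Open Scope ring_scope.

Section Berger.
Variables (R : realType) (E : vectType R).
Implicit Types (g h : {vspace 'End(E)}) (U V W : {vspace E}).

Definition curvature_tensor (T : {bilinear E -> E -> 'End(E)}) : Prop :=
  (forall x y, T x y = - T y x) /\
  (forall x y z, T x y z + T y z x + T z x y = 0).

Definition lie_bracket (a b : 'End(E)) : 'End(E) := (a \o b)%VF - (b \o a)%VF.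

Definition lie_subalgebra g : Prop :=
  {in g &, forall a b, lie_bracket a b \in g}.

Definition lie_generated (P : 'End(E) -> Prop) g : Prop :=
  [/\ lie_subalgebra g,
      forall a, P a -> a \in g
    & forall h, lie_subalgebra h -> (forall a, P a -> a \in h) -> (g <= h)%VS].

Definition berger g : Prop :=
  exists (m : nat) (T : 'I_m -> {bilinear E -> E -> 'End(E)}),
    (forall i, curvature_tensor (T i)) /\
    lie_generated (fun a => exists i x y, a = T i x y) g.

Definition supplementary U V : Prop := (U + V = fullv)%VS /\ directv (U + V).

Definition preserves_subspace g V : Prop :=
  forall a, a \in g -> (a @: V <= V)%VS.

Definition preserves_form g (B : {symmetric E}) : Prop :=
  forall a, a \in g -> forall x y, B (a x) y + B x (a y) = 0.

(* [daddv_pi U V] is the projection onto [U] along [V] when these are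
   supplementary, and has no meaning otherwise. *)
Definition theta V1 V2 W1 W2 : 'End(E) :=
  (daddv_pi W1 W2 \o daddv_pi V1 V2)%VF - (daddv_pi V1 V2 \o daddv_pi W1 W2)%VF.

(* The span of all [a x] with [a \in g] and [x \in U]; a basis of [g] is used
   only to make this a finite sum of subspaces, see [act_span_subP]. *)
Definition act_span g U : {vspace E} :=
  (\sum_(i < \dim g) (vbasis g)`_i @: U)%VS.

Lemma act_span_subP g U W :
  (act_span g U <= W)%VS <-> {in g & U, forall (a : 'End(E)) x, a x \in W}.
Proof.
split=> [sW a x ag xU | gW].
  rewrite (coord_vbasis ag) sum_lfunE; apply: rpred_sum => i _.
  rewrite scale_lfunE; apply: rpredZ; apply: (subvP sW).
  by apply: (subvP (sumv_sup i _ (subvv _))); rewrite // memv_img.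
apply/subv_sumP => i _; apply/subvP => _ /memv_imgP[x xU ->].
by apply: gW => //; rewrite vbasis_mem // mem_nth // size_tuple.
Qed.

End Berger.

(* Main.v *)
Require Import Defs.
From HB Require Import structures.
From mathcomp Require Import all_boot all_order all_algebra.
From mathcomp Require Import reals.
From mathcomp Require Import ring lra.

Set Implicit Arguments.
Unset Strict Implicit.
Unset Printing Implicit Defensive.

Import GRing.Theory.
Local Open Scope ring_scope.

(** Let [p] be the projection onto [V1] along [V2].  Its adjoint [q] for the
    form is the projection onto the orthogonal of [V2] along the orthogonal of
    [V1] ([adjoint_projection]), so [theta] is the commutator of [p] and [q].
    The algebra [g] commutes with [p] and is skew, hence commutes with [q] and
    with [theta]; both conclusions therefore say that [g] kills the image of
    [theta].  The endomorphisms doing so form a Lie subalgebra, and it is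
    enough to treat the generators [T x y] ([curvature_commutator]).

    As its values are skew for the form, a curvature tensor [T] has the pair
    symmetry [B (T x y z) t = B (T z t x) y].  Since [T x y] commutes with [p],
    this gives [T (p x) y = T x (q y)] ([curvature_adjoint]).  By the pair
    symmetry again, all the [T x y] kill the image of [theta] if and only if
    [T (p (q z)) t = T (q (p z)) t] for all [z] and [t], that is, if and only if
    [T (q z) (q t) = T (p z) (p t)] ([curvature_projection_adjoint]).

    For that identity, the Bianchi identity shows that [T (p x) (p y)] vanishes
    on [ker p], and likewise for [1 - p]; expanding, [T (p x) (p y) = S p] where
    [S = T (p x) y + T x (p y) - T x y].  The endomorphism [S] is unchanged when
    [p] and [q] are exchanged, so [T (q x) (q y) = S q].  Finally [S] is skew
    and commutes with [q], so the adjoint of [S p] is [- q S = - S q]; but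
    [S p] is skew, as a value of [T], and therefore [S p = S q]. *)

(** * Adjoints and orthogonal complements *)

Section Forms.
Context {R : realType} {E : vectType R}.
Variable B : {symmetric E}.
Implicit Types (x y z t : E) (V : {vspace E}) (a p q : 'End(E)).

Lemma symmetric_formC x y : B x y = B y x.
Proof. by rewrite hermC /= expr0 mul1r. Qed.

(** Being orthogonal to a spanning family of [V] is one linear equation per
    vector of the family. *)
Lemma dim_orthov_ge V : (\dim {:E} <= \dim V + \dim (orthov B V))%N.
Proof.
suff dim_span (s : seq E) : (\dim {:E} <= size s + \dim (orthov B <<s>>))%N.
  by have := dim_span (vbasis V); rewrite size_tuple (span_basis (vbasisP V)).
elim: s => [|v s IHs]; first by rewrite span_nil orthov0.
have sub : (orthov B <<s>> :&: orthov B <[v]> <= orthov B <<v :: s>>)%VS.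
  by rewrite span_cons orthovD capvSr capvSl.
apply: leq_trans IHs _; rewrite /= addSn -addnS leq_add2l.
apply: leq_trans (leqSpred _) _; rewrite ltnS.
exact: leq_trans (leq_dim_orthov1 B v _) (dimvS sub).
Qed.

Lemma nondegenerate_eq0 x : nondegenerate B -> (forall y, B x y = 0) -> x = 0.
Proof.
move=> /eqP radB Bx0; apply/eqP; rewrite -memv0 -radB.
by apply/mem_orthovP => y _; apply: Bx0.
Qed.

Lemma nondegenerate_inj x y :
  nondegenerate B -> (forall t, B x t = B y t) -> x = y.
Proof.
move=> ndB Bxy; apply/eqP; rewrite -subr_eq0; apply/eqP.
by apply: nondegenerate_eq0 => // t; rewrite linearBl /= Bxy subrr.
Qed.

(** The two orthogonals meet in the radical of the form, so the sum is direct,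
    and the dimension bounds make it everything. *)
Lemma supplementary_orthov (V1 V2 : {vspace E}) :
  nondegenerate B -> supplementary V1 V2 ->
  supplementary (orthov B V1) (orthov B V2).
Proof.
move=> ndB [V12 dV12].
have cap0 : (orthov B V1 :&: orthov B V2 = 0)%VS.
  by apply/eqP; rewrite -subv0 -(eqP ndB) -V12 orthovD capvSl capvSr.
split; last exact/directv_addP.
apply/eqP; rewrite -(dimv_leqif_eq (subvf _)) eqn_leq dimvS ?subvf //=.
rewrite (dimv_disjoint_sum cap0).
have dimV : (\dim V1 + \dim V2 = \dim {:E})%N.
  by rewrite -V12 dimv_disjoint_sum //; apply/directv_addP.
have := leq_add (dim_orthov_ge V1) (dim_orthov_ge V2).
by rewrite addnACA dimV leq_add2l.
Qed.

Definition adjoint p q := forall x y, B (p x) y = B x (q y).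

Lemma adjoint_sym p q : adjoint p q -> adjoint q p.
Proof. by move=> pq x y; rewrite symmetric_formC -pq symmetric_formC. Qed.

(** The image of the adjoint of [p] is the orthogonal of [ker p = V2] and its
    kernel is the orthogonal of [im p = V1]. *)
Lemma adjoint_projection (V1 V2 : {vspace E}) :
  nondegenerate B -> supplementary V1 V2 ->
  adjoint (daddv_pi V1 V2) (\1%VF - daddv_pi (orthov B V1) (orthov B V2)).
Proof.
move=> ndB sV x y; have [W12 /directv_addP dW] := supplementary_orthov ndB sV.
have [V12 /directv_addP dV] := sV.
have xE : daddv_pi V1 V2 x + daddv_pi V2 V1 x = x.
  by rewrite daddv_pi_add // V12 memvf.
have yE : daddv_pi (orthov B V1) (orthov B V2) y
        + daddv_pi (orthov B V2) (orthov B V1) y = y.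
  by rewrite daddv_pi_add // W12 memvf.
set p := daddv_pi V1 V2 in xE *; set r := daddv_pi _ _ in yE *.
have Bp w : w \in orthov B V1 -> B (p x) w = 0.
  by rewrite symmetric_formC => /mem_orthovP; apply; rewrite memv_pi.
have Bx w : w \in orthov B V2 -> B x w = B (p x) w.
  move=> /mem_orthovP wV2; rewrite -{1}xE linearDl /= -[RHS]addr0.
  congr (_ + _).
  by rewrite symmetric_formC wV2 ?memv_pi.
have -> : (\1%VF - r) y = daddv_pi (orthov B V2) (orthov B V1) y.
  by rewrite !lfun_simp /= -{1}yE addrC addKr.
by rewrite Bx ?memv_pi // -{1}yE linearDr /= Bp ?memv_pi // add0r.
Qed.

(** The adjoint of [p a = a p] is [- a q = - q a]. *)
Lemma skew_commute_adjoint p q a :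
  nondegenerate B -> adjoint p q ->
  (forall x y, B (a x) y + B x (a y) = 0) ->
  (forall z, p (a z) = a (p z)) -> forall z, q (a z) = a (q z).
Proof.
move=> ndB pq ask pa z; apply: nondegenerate_inj => // t.
have skew x y : B (a x) y = - B x (a y) by apply/eqP; rewrite -addr_eq0 ask.
have qp := adjoint_sym pq.
by rewrite qp skew -pa -qp skew.
Qed.

Lemma projection_commute (V1 V2 : {vspace E}) a :
  supplementary V1 V2 -> (a @: V1 <= V1)%VS -> (a @: V2 <= V2)%VS ->
  forall z, daddv_pi V1 V2 (a z) = a (daddv_pi V1 V2 z).
Proof.
move=> [V12 /directv_addP dV] aV1 aV2 z.
have aP V w : (a @: V <= V)%VS -> w \in V -> a w \in V.
  by move=> aV wV; apply: (subvP aV); rewrite memv_img.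
have dV' : (V2 :&: V1 = 0)%VS by rewrite capvC.
have zE : daddv_pi V1 V2 z + daddv_pi V2 V1 z = z.
  by rewrite daddv_pi_add // V12 memvf.
have aV2z : a (daddv_pi V2 V1 z) \in V2 by rewrite aP ?memv_pi.
rewrite -{1}zE !linearD /= (daddv_pi_id dV) ?aP ?memv_pi //.
apply/eqP; rewrite -subr_eq0 addrAC subrr add0r.
have := daddv_pi_add dV (_ : a (daddv_pi V2 V1 z) \in V1 + V2)%VS.
rewrite V12 memvf (daddv_pi_id dV' aV2z) => /(_ isT).
by move/(canRL (addrK _)) => ->; rewrite subrr.
Qed.

End Forms.

(** * Curvature tensors commuting with a projection *)

Section Curvature.
Context {R : realType} {E : vectType R}.
Variable T : {bilinear E -> E -> 'End(E)}.
Hypothesis curvT : curvature_tensor T.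
Implicit Types (x y z t : E) (p q : 'End(E)).

Lemma curvature_antisym x y z : T x y z = - T y x z.
Proof. by case: curvT => -> _; rewrite opp_lfunE. Qed.

Lemma curvatureBl x x' y z : T (x - x') y z = T x y z - T x' y z.
Proof. by rewrite linearBl /= !lfun_simp. Qed.

Lemma curvatureBr x y y' z : T x (y - y') z = T x y z - T x y' z.
Proof. by rewrite linearBr /= !lfun_simp. Qed.

Definition commutes_with p := forall x y z, p (T x y z) = T x y (p z).

(** For [u], [v] fixed by [p] and [w] killed by [p], applying [p] to the
    Bianchi identity kills [T u v w] and fixes the two other terms. *)
Lemma curvature_compress p x y z :
  (forall v, p (p v) = p v) -> commutes_with p ->
  T (p x) (p y) z = T (p x) (p y) (p z).
Proof.
move=> pp pT; have vanish u v w : p u = u -> p v = v -> p w = 0 -> T u v w = 0.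
  move=> pu pv pw; have bianchi := curvT.2 u v w.
  have := congr1 p bianchi.
  rewrite !linearD linear0 /= !pT pu pv pw linear0 add0r => fixed.
  by move: bianchi; rewrite -addrA fixed addr0.
apply/eqP; rewrite -subr_eq0 -linearB /= vanish //.
by rewrite linearB /= pp subrr.
Qed.

(** Besides [p], the complementary projection [1 - p] satisfies
    [curvature_compress]; on the image of [p] this makes
    [T (x - p x) (y - p y)] vanish. *)
Lemma curvature_compress_expand p x y z :
  (forall v, p (p v) = p v) -> commutes_with p ->
  T (p x) (p y) z = T (p x) y (p z) + T x (p y) (p z) - T x y (p z).
Proof.
move=> pp pT; rewrite curvature_compress //.
have cc v : (\1%VF - p) v = v - p v by rewrite !lfun_simp.
have := @curvature_compress (\1%VF - p) x y (p z).
rewrite !cc pp subrr linear0 !(curvatureBl, curvatureBr) => compress.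
have /compress : forall v, (\1%VF - p) ((\1%VF - p) v) = (\1%VF - p) v.
  by move=> v; rewrite !cc linearB /= pp subrr subr0.
have commC : commutes_with (\1%VF - p).
  by move=> ? ? ?; rewrite !cc pT linearB.
move/(_ commC).
move: (T x y _) (T (p x) y _) (T x (p y) _) (T (p x) (p y) _) => a b c d.
move/eqP; rewrite opprB addrA subr_eq0 => /eqP <-.
by rewrite [a - c + d]addrAC subrK addrAC subrr add0r.
Qed.

Section Metric.
Variable B : {symmetric E}.
Hypothesis skewT : forall x y z t, B (T x y z) t + B z (T x y t) = 0.

Lemma curvature_skew x y z t : B (T x y z) t = - B z (T x y t).
Proof. by apply/eqP; rewrite -addr_eq0 skewT. Qed.

(** The classical octahedron argument: the four cyclic sums of the Bianchi
    identity, one for each argument left fixed, combine with suitable signs into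
    twice the claim. *)
Lemma curvature_pair_symmetry x y z t : B (T x y z) t = B (T z t x) y.
Proof.
have anti1 u v w s : B (T u v w) s = - B (T v u w) s.
  by rewrite curvature_antisym linearNl.
have anti2 u v w s : B (T u v w) s = - B (T u v s) w.
  by rewrite curvature_skew symmetric_formC.
have bianchi u v w s : B (T u v w) s + B (T v w u) s + B (T w u v) s = 0.
  by rewrite -!(linearDl B) /= curvT.2 linear0l.
(* Skewness in each pair of slots writes the four identities with
   [B (T x y z) t], [B (T z t x) y] and the two analogous pairs of terms. *)
have := bianchi x y z t; have := bianchi y z t x.
have := bianchi z t x y; have := bianchi t x y z.
rewrite (anti1 t x y) (anti2 x y t) (anti2 y t x).
rewrite (anti1 t x z) (anti2 x t z) (anti1 x z t) (anti2 z x t).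
rewrite (anti2 y z t) (anti2 z t y) (anti1 t y z).
lra.
Qed.

Hypothesis ndB : nondegenerate B.

(** The relation [T x y (p z) = p (T x y z)], read through pair symmetry. *)
Lemma curvature_adjoint p q x y z :
  adjoint B p q -> commutes_with p -> T (p x) y z = T x (q y) z.
Proof.
move=> pq pT; apply: (nondegenerate_inj ndB) => t.
by rewrite curvature_pair_symmetry -pT pq curvature_pair_symmetry.
Qed.

(** With [S = T (p x) y + T x (p y) - T x y], which is symmetric in [p] and
    [q], the two sides are [S p] and [S q]; they agree because [S p] is skew. *)
Lemma curvature_projection_adjoint p q x y z :
  adjoint B p q -> (forall v, p (p v) = p v) ->
  commutes_with p -> commutes_with q ->
  T (p x) (p y) z = T (q x) (q y) z.
Proof.
move=> pq pp pT qT; have qp := adjoint_sym pq.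
have qq v : q (q v) = q v.
  by apply: (nondegenerate_inj ndB) => t; rewrite !qp pp.
pose S := T (p x) y + T x (p y) - T x y.
have Sp v : T (p x) (p y) v = S (p v).
  by rewrite curvature_compress_expand // !lfun_simp.
have Sq v : T (q x) (q y) v = S (q v).
  rewrite curvature_compress_expand // !lfun_simp; congr (_ - _).
  by rewrite (curvature_adjoint _ _ _ qp qT) -(curvature_adjoint _ _ _ pq pT)
    addrC.
have S_skew v w : B (S v) w = - B v (S w).
  by rewrite !lfun_simp !(linearDl, linearNl, linearDr, linearNr) /=
    !curvature_skew; ring.
have S_q v : q (S v) = S (q v) by rewrite !lfun_simp !linearD linearN /= !qT.
apply: (nondegenerate_inj ndB) => t.
by rewrite Sq curvature_skew Sp -S_q qp S_skew.
Qed.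

(** Pair symmetry moves the commutator into the first slot of [T], where one
    of the two factors can be passed to the second slot as its adjoint. *)
Lemma curvature_commutator p q x y z :
  adjoint B p q -> (forall v, p (p v) = p v) ->
  commutes_with p -> commutes_with q ->
  T x y (p (q z) - q (p z)) = 0.
Proof.
move=> pq pp pT qT; have qp := adjoint_sym pq.
apply: (nondegenerate_inj ndB) => t.
rewrite curvature_pair_symmetry curvatureBl linearBl /=.
rewrite (curvature_adjoint (q z) _ _ pq pT) (curvature_adjoint (p z) _ _ qp qT).
by rewrite (curvature_projection_adjoint _ _ _ pq) // subrr linear0l.
Qed.

End Metric.
End Curvature.

(** * Endomorphisms killing the image of a given one *)

Section Annihilator.
Context {R : realType} {E : vectType R}.
Variable c : 'End(E).

Definition precomp (a : 'End(E)) : 'End(E) := (a \o c)%VF.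

Lemma precomp_is_linear : linear precomp.
Proof. by move=> k a b; rewrite /precomp comp_lfunDl comp_lfunZl. Qed.

HB.instance Definition _ :=
  GRing.isLinear.Build R 'End(E) 'End(E) _ precomp precomp_is_linear.

Definition annihilator : {vspace 'End(E)} := lker (linfun precomp).

Lemma mem_annihilatorP (a : 'End(E)) :
  reflect (forall z, a (c z) = 0) (a \in annihilator).
Proof.
rewrite memv_ker lfunE /=; apply: (iffP eqP) => [ac0 z|ac0].
  by rewrite -comp_lfunE -/(precomp a) ac0 lfunE.
by apply/lfunP => z; rewrite comp_lfunE ac0 lfunE.
Qed.

(** The minimality of a generated Lie algebra is applied to this subalgebra, to
    pass from the generators to the whole algebra. *)
Lemma annihilator_lie : lie_subalgebra annihilator.
Proof.
move=> a b /mem_annihilatorP ac /mem_annihilatorP bc.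
by apply/mem_annihilatorP => z; rewrite !lfun_simp ac bc !linear0 addr0.
Qed.

End Annihilator.

Theorem theorem40 (R : realType) (E : vectType R) (g : {vspace 'End(E)})
    (V1 V2 : {vspace E}) (B : {symmetric E}) :
  berger g ->
  supplementary V1 V2 ->
  preserves_subspace g V1 ->
  preserves_subspace g V2 ->
  nondegenerate B ->
  preserves_form g B ->
  let th := theta V1 V2 (orthov B V1) (orthov B V2) in
  (act_span g fullv <= lker th)%VS /\ act_span g (limg th) = 0%VS.
Proof.
move=> [m [T [curvT [_ Tg g_min]]]] sV gV1 gV2 ndB gB th.
pose p := daddv_pi V1 V2; pose r := daddv_pi (orthov B V1) (orthov B V2).
pose q : 'End(E) := \1%VF - r.
have pq : adjoint B p q := adjoint_projection ndB sV.
have pp v : p (p v) = p v.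
  by apply: daddv_pi_proj; apply/directv_addP; case: sV.
have thE z : th z = p (q z) - q (p z).
  by rewrite !lfun_simp linearB /= -/p -/r opprB [RHS]addrC addrA subrK.
have g_p a : a \in g -> forall z, p (a z) = a (p z).
  by move=> ag; apply: projection_commute => //; [apply: gV1 | apply: gV2].
have g_q a : a \in g -> forall z, q (a z) = a (q z).
  by move=> ag; apply: (skew_commute_adjoint ndB pq (gB a ag)); apply: g_p.
have ath a : a \in g -> forall z, a (th z) = 0.
  move=> ag; apply/mem_annihilatorP; apply: (subvP (g_min _ _ _)) ag.
    exact: annihilator_lie.
  move=> _ [i [x [y ->]]]; apply/mem_annihilatorP => z; rewrite thE.
  have Tig u v : T i u v \in g by apply: Tg; exists i, u, v.
  apply: (curvature_commutator (curvT i) _ ndB _ _ _ pq) => //.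
  - by move=> u v; apply: gB.
  - by move=> u v; apply: g_p.
  - by move=> u v; apply: g_q.
split.
- apply/act_span_subP => a x ag _; rewrite memv_ker thE.
  rewrite (g_q a) // !(g_p a) // (g_q a) //.
  by rewrite -linearB /= -thE ath.
- apply/eqP; rewrite -subv0; apply/act_span_subP => a _ ag /memv_imgP[z _ ->].
  by rewrite ath // mem0v.
Qed.
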